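(* Let $S$ be an inverse semigroup and let $(X,E(S),p)$ be a presheaf over $E(S)$. Then the following are equivalent: (1) There exists an idempotent-separating homomorphism $\phi\colon S\to T_X$ whose image is a wide inverse subsemigroup of the generalised Munn semigroup $T_X$ of $(X,E(S),p)$. (2) There exists a supported action $(X,S,\overline{p})$ such that the presheaf obtained by restricting it to the idempotents of $S$ is isomorphic to $(X,E(S),p)$.
   Context: For an inverse semigroup $S$, $E(S)$ is its semilattice of idempotents. An inverse subsemigroup is wide if it contains all idempotents. A homomorphism is idempotent-separating if it is injective on idempotents. ''Semilattice'' means meet-semilattice, i.e. a commutative semigroup of idempotents, with $e\le f\iff e=ef$; $e^{\downarrow}=\{f: f\le e\}$. A supported (right) action $(X,S,p)$ of an inverse semigroup $S$ on a set $X$ consists of maps $X\times S\to X$, $(x,s)\mapsto x\cdot s$, and $p\colon X\to E(S)$ such that for all $x\in X$, $s,t\in S$: (SA1) $(x\cdot s)\cdot t=x\cdot st$; (SA2) $x\cdot p(x)=x$; (SA3) $p(x\cdot s)=s^{-1}p(x)s$. A homomorphism $(X,S,p)\to(Y,T,q)$ is a pair $(\alpha,\theta)$ of a function $\alpha\colon X\to Y$ and a semigroup homomorphism $\theta\colon S\to T$ with $\alpha(x\cdot s)=\alpha(x)\cdot\theta(s)$ and $q(\alpha(x))=\theta(p(x))$ for all $x\in X$, $s\in S$; it is an isomorphism if both components are bijective. A presheaf $(X,E,p)$ over a semilattice $E$ is a supported action of $E$; isomorphism of presheaves means isomorphism of supported actions in this sense (the component on semilattices may be a non-identity isomorphism).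 The partial order on $X$ is $x\le y\iff x=y\cdot p(x)$. For a presheaf $(X,E,p)$ and $e\in E$, the principal subpresheaf at $e$ is $(X\cdot e,e^{\downarrow},p_e)$ with $X\cdot e=\{x\cdot e:x\in X\}=\{x\in X:p(x)\le e\}$ and $p_e=p|_{X\cdot e}$. An isomorphism from the principal subpresheaf at $e$ to that at $f$ is a pair $(\alpha,\theta)$ of order-isomorphisms $\alpha\colon X\cdot e\to X\cdot f$, $\theta\colon e^{\downarrow}\to f^{\downarrow}$ with $p(\alpha(x))=\theta(p(x))$ for all $x\in X\cdot e$. The generalised Munn semigroup $T_X$ of $(X,E,p)$ is the set of all such isomorphisms between principal subpresheaves of $X$, with product $(\alpha,\theta)(\beta,\phi)=(\alpha\beta,\theta\phi)$, componentwise composition of partial bijections (right factor applied first, on the largest possible domain); it is an inverse semigroup. *)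

(* Defs.v *)
From HB Require Import structures.
From mathcomp Require Import all_boot.
From mathcomp Require Import boolp classical_sets.

Set Implicit Arguments.
Unset Strict Implicit.
Unset Printing Implicit Defensive.

Local Open Scope classical_set_scope.
Local Open Scope group_scope.

HB.mixin Record Semigroup_isInvSemigroup S of Semigroup S := {
  sinv : S -> S;
  mulsVs : forall s : S, s * sinv s * s = s;
  mulVsV : forall s : S, sinv s * s * sinv s = sinv s;
  sinv_uniq : forall s t : S, s * t * s = s -> t * s * t = t -> t = sinv s
}.

#[short(type="invSemigroupType")]
HB.structure Definition InvSemigroup :=
  { S of Semigroup_isInvSemigroup S & Semigroup S }.

Bind Scope group_scope with InvSemigroup.sort.

HB.mixin Record InvSemigroup_isSemilattice E of InvSemigroup E := {
  mulss : forall e : E, e * e = e;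
  mulsC : forall e f : E, e * f = f * e
}.

#[short(type="semilatticeType")]
HB.structure Definition Semilattice :=
  { E of InvSemigroup_isSemilattice E & InvSemigroup E }.

Bind Scope group_scope with Semilattice.sort.

Definition sle (E : semilatticeType) (e f : E) : Prop := e = e * f.

Definition idem (S : semigroupType) : pred S := fun e => e * e == e.

Section Idempotents.
Variable S : invSemigroupType.
Implicit Types e f s : S.

Lemma idemE e : idem e -> e * e = e. Proof. by move/eqP. Qed.

Lemma sinv_idem e : idem e -> sinv e = e.
Proof. by move=> /idemE ee; apply/esym/sinv_uniq; rewrite !ee. Qed.

Lemma sinvK : involutive (@sinv S).
Proof. by move=> s; apply/esym/sinv_uniq; rewrite (mulVsV, mulsVs). Qed.

Lemma idemM e f : idem e -> idem f -> idem (e * f).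
Proof.
move=> /idemE ee /idemE ff; set x := sinv (e * f).
have xE : f * x * e = x.
  apply: sinv_uniq; rewrite !mulgA.
    rewrite -(mulgA e f f) ff -(mulgA _ e e) ee -(mulgA _ e f).
    exact: mulsVs.
  rewrite -(mulgA _ e e) ee -(mulgA _ f f) ff.
  have := mulVsV (e * f); rewrite -/x !mulgA => h.
  by rewrite -[in RHS]h !mulgA.
have xx : idem x.
  apply/eqP; rewrite -{1 2}xE !mulgA.
  have := mulVsV (e * f); rewrite -/x !mulgA => h.
  by rewrite -[in RHS]xE -[in RHS]h !mulgA.
by rewrite -[e * f]sinvK -/x sinv_idem.
Qed.

Lemma idemC e f : idem e -> idem f -> e * f = f * e.
Proof.
move=> ie if_; have /idemE ef := idemM ie if_; have /idemE fe := idemM if_ ie.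
rewrite -[e * f]sinv_idem ?idemM //; apply/esym/sinv_uniq.
  by rewrite !mulgA -(mulgA e f f) (idemE if_) -(mulgA _ e e) (idemE ie) -mulgA.
by rewrite !mulgA -(mulgA f e e) (idemE ie) -(mulgA _ f f) (idemE if_) -mulgA.
Qed.

End Idempotents.

Record idemType (S : invSemigroupType) :=
  Idem { idem_val :> S; idem_valP : idem idem_val }.

Notation "''E' ( S )" := (idemType S)
  (at level 8, format "''E' ( S )") : type_scope.

Section IdempotentSemilattice.
Variable S : invSemigroupType.

HB.instance Definition _ := [isSub for @idem_val S].
HB.instance Definition _ := [Choice of 'E(S) by <:].

Let mulE (e f : 'E(S)) : 'E(S) := Idem (idemM (idem_valP e) (idem_valP f)).

Let mulEA : associative mulE.
Proof. by move=> e f g; apply: val_inj; rewrite /= mulgA. Qed.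

HB.instance Definition _ := isSemigroup.Build 'E(S) mulEA.

Lemma idem_valM (e f : 'E(S)) : idem_val (e * f) = idem_val e * idem_val f.
Proof. by []. Qed.

Let mulEE (e : 'E(S)) : e * e = e.
Proof. by apply: val_inj; exact: idemE (idem_valP e). Qed.

Let mulEC (e f : 'E(S)) : e * f = f * e.
Proof. by apply: val_inj; exact: idemC (idem_valP e) (idem_valP f). Qed.

Let mulEEE (e : 'E(S)) : e * e * e = e.
Proof. by rewrite !mulEE. Qed.

Let invE_uniq (e f : 'E(S)) : e * f * e = e -> f * e * f = f -> f = e.
Proof.
move=> efe fef; rewrite -efe -[LHS]fef (mulEC f e) -mulgA mulEE.
by rewrite -mulgA (mulEC f e) mulgA mulEE.
Qed.

HB.instance Definition _ :=
  @Semigroup_isInvSemigroup.Build 'E(S) (fun e => e) mulEEE mulEEE invE_uniq.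
HB.instance Definition _ :=
  InvSemigroup_isSemilattice.Build 'E(S) mulEE mulEC.

End IdempotentSemilattice.

(* The support map X -> E(S) is given by its values in S together with
   supp_idem; over a semilattice every element is idempotent and supp_idem
   imposes nothing. *)
Record supported_action (X : Type) (S : invSemigroupType) := SupportedAction {
  act : X -> S -> X;
  supp : X -> S;
  supp_idem : forall x, idem (supp x);
  actM : forall x s t, act (act x s) t = act x (s * t);
  act_supp : forall x, act x (supp x) = x;
  supp_act : forall x s, supp (act x s) = sinv s * supp x * s
}.

Definition sact_hom (X Y : Type) (S T : invSemigroupType)
    (A : supported_action X S) (B : supported_action Y T)
    (alpha : X -> Y) (theta : {multiplicative S -> T}) : Prop :=
  (forall x s, alpha (act A x s) = act B (alpha x) (theta s)) /\
  (forall x, supp B (alpha x) = theta (supp A x)).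

Definition sact_isomorphic (X Y : Type) (S T : invSemigroupType)
    (A : supported_action X S) (B : supported_action Y T) : Prop :=
  exists (alpha : X -> Y) (theta : {multiplicative S -> T}),
    [/\ sact_hom A B alpha theta, bijective alpha & bijective theta].

Definition presheaf (X : Type) (E : semilatticeType) := supported_action X E.

Section Restriction.
Variables (X : Type) (S : invSemigroupType) (A : supported_action X S).

Let ract (x : X) (e : 'E(S)) := act A x e.
Let rsupp (x : X) : 'E(S) := Idem (supp_idem A x).

Let rsupp_idem x : idem (rsupp x).
Proof. by apply/eqP/mulss. Qed.

Let ractM x (e f : 'E(S)) : ract (ract x e) f = ract x (e * f).
Proof. by rewrite /ract actM idem_valM. Qed.

Let ract_supp x : ract x (rsupp x) = x.
Proof. exact: act_supp. Qed.

Let rsupp_act x (e : 'E(S)) : rsupp (ract x e) = sinv e * rsupp x * e.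
Proof.
by apply: val_inj; rewrite /= supp_act (sinv_idem (idem_valP e)).
Qed.

Definition restrict_idem : presheaf X 'E(S) :=
  SupportedAction rsupp_idem ractM ract_supp rsupp_act.

End Restriction.

Section PartialBijections.
Variable T : Type.

(* A partial bijection is kept together with its inverse, which it determines;
   two partial bijections with the same graph are equal (partial_bijP). *)
Record partial_bij := PartialBij {
  pb_fun :> T -> option T;
  pb_inv : T -> option T;
  pb_funK : forall x y, pb_fun x = Some y <-> pb_inv y = Some x
}.

Lemma partial_bijP (a b : partial_bij) :
  (forall x y, a x = Some y <-> b x = Some y) -> a = b.
Proof.
case: a b => [f f' fK] [g g' gK] /= fg.
have opt (u v : option T) : (forall y, u = Some y <-> v = Some y) -> u = v.
  case: u v => [x|] [y|] h //; first by have [/(_ erefl)] := h x.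
    by have [/(_ erefl)] := h x.
  by have [_ /(_ erefl)] := h y.
have e : f = g by apply/funext => x; apply: opt.
have e' : f' = g'.
  by apply/funext => y; apply: opt => x; rewrite -fK -gK e.
by move: fK gK; rewrite e e' => fK gK; congr PartialBij; apply: Prop_irrelevance.
Qed.

Lemma pb_inj (a : partial_bij) x x' y : a x = Some y -> a x' = Some y -> x = x'.
Proof. by move=> /pb_funK ax /pb_funK; rewrite ax => -[]. Qed.

Let comp_funK (a b : partial_bij) x y :
  pcomp a b x = Some y <-> pcomp (pb_inv b) (pb_inv a) y = Some x.
Proof.
rewrite /pcomp; split.
  case E : (b x) => [z|//] /= az; move/pb_funK: E => E.
  by move/pb_funK: az => ->.
case E : (pb_inv a y) => [z|//] /= bz; move/pb_funK: E => E.
by move/pb_funK: bz => ->.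
Qed.

(* The right factor is applied first, on the largest possible domain. *)
Definition pb_comp (a b : partial_bij) : partial_bij :=
  PartialBij (comp_funK a b).

Definition pb_converse (a : partial_bij) : partial_bij :=
  PartialBij (fun x y => iff_sym (pb_funK a y x)).

Definition pb_dom (a : partial_bij) : set T := [set x | exists y, a x = Some y].
Definition pb_cod (a : partial_bij) : set T := [set y | exists x, a x = Some y].

Lemma pb_compP (a b : partial_bij) x z :
  pb_comp a b x = Some z <-> exists2 y, b x = Some y & a y = Some z.
Proof.
rewrite /= /pcomp; case: (b x) => [y|] /=; split => //.
- by move=> h; exists y.
- by case=> _ [<-].
- by case.
Qed.

Lemma pb_converseP (a : partial_bij) x y :
  pb_converse a y = Some x <-> a x = Some y.
Proof. by split=> /pb_funK. Qed.

Lemma pb_compA : associative pb_comp.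
Proof.
move=> a b c; apply: partial_bijP => x w; split.
  case/pb_compP => z /pb_compP[y cx bx] az.
  by apply/pb_compP; exists y => //; apply/pb_compP; exists z.
case/pb_compP => y cx /pb_compP[z bx az].
by apply/pb_compP; exists z => //; apply/pb_compP; exists y.
Qed.

Lemma pb_compVK (a : partial_bij) : pb_comp (pb_comp a (pb_converse a)) a = a.
Proof.
apply: partial_bijP => x y; split.
  case/pb_compP => y1 ax /pb_compP[x1] /pb_converseP ax1 ax1'.
  by rewrite (pb_inj ax ax1).
move=> ax; apply/pb_compP; exists y => //.
by apply/pb_compP; exists x => //; apply/pb_converseP.
Qed.

Lemma pb_converseK : involutive pb_converse.
Proof. by case=> f g fg; apply: partial_bijP. Qed.

Lemma pb_converse_uniq (a b : partial_bij) :
  pb_comp (pb_comp a b) a = a -> pb_comp (pb_comp b a) b = b ->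
  b = pb_converse a.
Proof.
have half (c d : partial_bij) x y : pb_comp (pb_comp c d) c = c ->
    c x = Some y -> d y = Some x.
  move=> cdc cx; move: (cx); rewrite -{1}cdc.
  case/pb_compP => y1; rewrite cx => -[<-] /pb_compP[z dy cz].
  by rewrite dy (pb_inj cz cx).
move=> aba bab; apply: partial_bijP => y x; split.
  by move=> by_; apply/pb_converseP; apply: half by_.
by move/pb_converseP; apply: half.
Qed.

End PartialBijections.

(* An order-isomorphism from the subset A onto the subset B of T. *)
Definition order_iso (T : Type) (le : T -> T -> Prop) (A B : set T)
    (a : partial_bij T) : Prop :=
  [/\ pb_dom a = A, pb_cod a = B &
      forall x x' y y', a x = Some y -> a x' = Some y' -> (le x x' <-> le y y')].

Section GeneralisedMunn.
Variables (X : Type) (E : semilatticeType) (P : presheaf X E).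
Implicit Types e f g : E.

Definition ple (x y : X) : Prop := x = act P y (supp P x).

Definition principal (e : E) : set X := range (act P ^~ e).

Definition down (e : E) : set E := [set f | sle f e].

Definition principal_iso (e f : E) (alpha : partial_bij X)
    (theta : partial_bij E) : Prop :=
  [/\ order_iso ple (principal e) (principal f) alpha,
      order_iso (@sle E) (down e) (down f) theta &
      forall x y, alpha x = Some y -> theta (supp P x) = Some (supp P y)].

(* The generalised Munn semigroup T_X; its product is munn_mul. *)
Record munn := Munn {
  munn_fst : partial_bij X;
  munn_snd : partial_bij E;
  munn_iso : exists e f, principal_iso e f munn_fst munn_snd
}.

Lemma sle_trans e f g : sle e f -> sle f g -> sle e g.
Proof. by rewrite /sle => -> ->; rewrite -!mulgA mulss. Qed.

Lemma sle_refl e : sle e e.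
Proof. by rewrite /sle mulss. Qed.

Lemma sle_meet e f g : sle g (e * f) <-> sle g e /\ sle g f.
Proof.
split=> [-> | []]; last by rewrite /sle => ge gf; rewrite mulgA -ge.
rewrite /sle; split; first by rewrite (mulsC e) -!mulgA mulss.
by rewrite -!mulgA mulss.
Qed.

Lemma supp_actE x e : supp P (act P x e) = supp P x * e.
Proof.
have ie : idem e by apply/eqP/mulss.
by rewrite supp_act (sinv_idem ie) mulsC mulgA mulss mulsC.
Qed.

Lemma principalE e x : principal e x <-> sle (supp P x) e.
Proof.
split=> [[y _ <-]|xe]; first by rewrite supp_actE /sle -mulgA mulss.
by exists x => //; rewrite -{1}(act_supp P x) actM -xe act_supp.
Qed.

Lemma order_iso_converse (T : Type) (le : T -> T -> Prop) A B
    (a : partial_bij T) :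
  order_iso le A B a -> order_iso le B A (pb_converse a).
Proof.
case=> domA codB mon; split.
- by rewrite -codB; apply/seteqP; split=> y [x] /pb_converseP ax; exists x.
- by rewrite -domA; apply/seteqP; split=> x [y] /pb_converseP ax; exists y.
- move=> y y' x x' /pb_converseP ax /pb_converseP ax'.
  by split=> /(mon _ _ _ _ ax ax').
Qed.

Lemma principal_iso_converse e f alpha theta :
  principal_iso e f alpha theta ->
  principal_iso f e (pb_converse alpha) (pb_converse theta).
Proof.
case=> isoa isot comm; split; try exact: order_iso_converse.
by move=> y x /pb_converseP /comm /pb_converseP.
Qed.

Lemma munn_iso_converse alpha theta :
  (exists e f, principal_iso e f alpha theta) ->
  exists e f, principal_iso e f (pb_converse alpha) (pb_converse theta).
Proof. by case=> e [f] /principal_iso_converse; exists f, e. Qed.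

(* If (beta, phi) : g -> h and (alpha, theta) : e -> f, then the composite is
   defined on the principal subpresheaf at the preimage k of h * e under phi.
   The domain computations for alpha beta and for theta phi are the instances
   r = supp P and r = id of the next lemma. *)
Lemma dom_cod_comp (T : Type) (r : T -> E) (le : T -> T -> Prop)
    (a b : partial_bij T) (theta phi : partial_bij E) e f g h k l :
  order_iso (@sle E) (down e) (down f) theta ->
  order_iso (@sle E) (down g) (down h) phi ->
  order_iso le [set x | sle (r x) e] [set x | sle (r x) f] a ->
  order_iso le [set x | sle (r x) g] [set x | sle (r x) h] b ->
  (forall x y, a x = Some y -> theta (r x) = Some (r y)) ->
  (forall x y, b x = Some y -> phi (r x) = Some (r y)) ->
  phi k = Some (h * e) -> theta (h * e) = Some l ->
  order_iso le [set x | sle (r x) k] [set x | sle (r x) l] (pb_comp a b).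
Proof.
move=> [domt codt mont] [domp codp monp] [doma coda mona] [domb codb monb].
move=> commt commp phik thetal.
have kg : sle k g by have : pb_dom phi k by [exists (h * e)]; rewrite domp.
have lf : sle l f by have : pb_cod theta l by [exists (h * e)]; rewrite codt.
have domaP x y : a x = Some y -> sle (r x) e.
  by move=> axy; have : pb_dom a x by [exists y]; rewrite doma.
have codbP x y : b x = Some y -> sle (r y) h.
  by move=> bxy; have : pb_cod b y by [exists x]; rewrite codb.
split.
- apply/seteqP; split=> x /=.
    case=> z /pb_compP[y bx ay]; apply/(monp _ _ _ _ (commp _ _ bx) phik).
    by apply/sle_meet; split; [exact: codbP bx|exact: domaP ay].
  move=> xk; have [y bx] : pb_dom b x by rewrite domb; exact: sle_trans kg.
  have /sle_meet[_ ye] : sle (r y) (h * e).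
    by apply/(monp _ _ _ _ (commp _ _ bx) phik).
  have [z ay] : pb_dom a y by rewrite doma.
  by exists z; apply/pb_compP; exists y.
- apply/seteqP; split=> z /=.
    case=> x /pb_compP[y bx ay]; apply/(mont _ _ _ _ (commt _ _ ay) thetal).
    by apply/sle_meet; split; [exact: codbP bx|exact: domaP ay].
  move=> zl; have [y ay] : pb_cod a z by rewrite coda; exact: sle_trans lf.
  have /sle_meet[yh _] : sle (r y) (h * e).
    by apply/(mont _ _ _ _ (commt _ _ ay) thetal).
  have [x bx] : pb_cod b y by rewrite codb.
  by exists x; apply/pb_compP; exists y.
- move=> x x' z z' /pb_compP[y bx ay] /pb_compP[y' bx' ay'].
  by rewrite (monb _ _ _ _ bx bx') (mona _ _ _ _ ay ay').
Qed.

Lemma munn_iso_comp alpha theta beta phi :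
  (exists e f, principal_iso e f alpha theta) ->
  (exists g h, principal_iso g h beta phi) ->
  exists k l, principal_iso k l (pb_comp alpha beta) (pb_comp theta phi).
Proof.
move=> [e [f [isoa isot commt]]] [g [h [isob isop commp]]].
have prE c : principal c = [set x | sle (supp P x) c].
  by apply/seteqP; split=> x /principalE.
have [k phik] : pb_cod phi (h * e).
  case: isop => _ -> _; have [] := (sle_meet h e (h * e)).1 => //.
  exact: sle_refl.
have [l thetal] : pb_dom theta (h * e).
  case: isot => -> _ _; have [] := (sle_meet h e (h * e)).1 => //.
  exact: sle_refl.
rewrite !prE in isoa isob; exists k, l; split.
- by rewrite !prE; exact: dom_cod_comp isot isop isoa isob commt commp phik thetal.
- exact: (@dom_cod_comp E id (@sle E) theta phi theta phi e f g h).
- move=> x z /pb_compP[y bx ay]; apply/pb_compP.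
  by exists (supp P y); [apply: commp|apply: commt].
Qed.

Definition munn_mul (a b : munn) : munn :=
  Munn (munn_iso_comp (munn_iso a) (munn_iso b)).

Definition munn_inv (a : munn) : munn := Munn (munn_iso_converse (munn_iso a)).

Lemma munnP (a b : munn) :
  munn_fst a = munn_fst b -> munn_snd a = munn_snd b -> a = b.
Proof.
case: a b => [a1 a2 aP] [b1 b2 bP] /= e1 e2.
move: aP bP; rewrite e1 e2 => aP bP; congr Munn; exact: Prop_irrelevance.
Qed.

HB.instance Definition _ := gen_eqMixin munn.
HB.instance Definition _ := gen_choiceMixin munn.

Let munn_mulA : associative munn_mul.
Proof. by move=> a b c; apply: munnP; apply: pb_compA. Qed.

HB.instance Definition _ := isSemigroup.Build munn munn_mulA.

Let munn_mulVK (a : munn) : a * munn_inv a * a = a.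
Proof. by apply: munnP; apply: pb_compVK. Qed.

Let munn_mulKV (a : munn) : munn_inv a * a * munn_inv a = munn_inv a.
Proof.
by apply: munnP; [have := pb_compVK (pb_converse (munn_fst a))
  |have := pb_compVK (pb_converse (munn_snd a))]; rewrite pb_converseK.
Qed.

Let munn_inv_uniq (a b : munn) :
  a * b * a = a -> b * a * b = b -> b = munn_inv a.
Proof.
move=> aba bab; apply: munnP; apply: pb_converse_uniq.
- by have := congr1 munn_fst aba.
- by have := congr1 munn_fst bab.
- by have := congr1 munn_snd aba.
- by have := congr1 munn_snd bab.
Qed.

HB.instance Definition _ :=
  @Semigroup_isInvSemigroup.Build munn munn_inv
    munn_mulVK munn_mulKV munn_inv_uniq.

End GeneralisedMunn.

Definition idem_separating (S T : invSemigroupType) (phi : S -> T) : Prop :=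
  {in @idem S &, injective phi}.

Definition inv_subsemigroup (T : invSemigroupType) (A : set T) : Prop :=
  (forall s t, A s -> A t -> A (s * t)) /\ (forall s, A s -> A (sinv s)).

Definition wide (T : invSemigroupType) (A : set T) : Prop :=
  forall e : T, idem e -> A e.

(* Main.v *)
(* The idempotents of T_X are the identities of the principal subpresheaves, so
   E(T_X) is a copy of E. Given an action of S, s is sent to the isomorphism
   x |-> x . s^-1 from the principal subpresheaf at s^-1 s to the one at s s^-1,
   paired with conjugation e |-> s e s^-1. Conversely, an idempotent-separating
   phi with wide image restricts to an isomorphism theta of E(S) onto E, and
   x . s := phi(s)^-1 (x . theta(s s^-1)) is a supported action of S with
   support theta^-1 (p x). Its associativity rests on the elements of T_X being
   equivariant, and on phi(s) inducing conjugation by s on idempotents. *)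

Require Import Defs.
From HB Require Import structures.
From mathcomp Require Import all_boot.
From mathcomp Require Import boolp classical_sets.

Set Implicit Arguments.
Unset Strict Implicit.
Unset Printing Implicit Defensive.

Local Open Scope classical_set_scope.
Local Open Scope group_scope.

(** * Inverses of products, and conjugation of idempotents *)

Section InverseSemigroups.
Variable S : invSemigroupType.
Implicit Types s t : S.

Lemma idem_sVs s : idem (sinv s * s).
Proof. by apply/eqP; rewrite mulgA mulVsV. Qed.

Lemma idem_ssV s : idem (s * sinv s).
Proof. by apply/eqP; rewrite mulgA mulsVs. Qed.

Lemma sinvM s t : sinv (s * t) = sinv t * sinv s.
Proof.
have st := idemC (idem_ssV t) (idem_sVs s).
apply/esym/sinv_uniq.
  transitivity (s * ((t * sinv t) * (sinv s * s)) * t); first by rewrite !mulgA.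
  by rewrite st !mulgA mulsVs -!mulgA (mulgA t) mulsVs.
transitivity (sinv t * ((sinv s * s) * (t * sinv t)) * sinv s).
  by rewrite !mulgA.
by rewrite -st !mulgA mulVsV -!mulgA (mulgA (sinv s)) mulVsV.
Qed.

Lemma idem_conj s e : idem e -> idem (sinv s * e * s).
Proof.
move=> ie; have -> : sinv s * e * s = sinv (e * s) * (e * s).
  by rewrite sinvM (sinv_idem ie) !mulgA -(mulgA (sinv s) e e) (idemE ie).
exact: idem_sVs.
Qed.

Lemma gmulfV (T : invSemigroupType) (f : {multiplicative S -> T}) s :
  f (sinv s) = sinv (f s).
Proof. by apply: sinv_uniq; rewrite -!gmulfM (mulsVs, mulVsV). Qed.

Definition idem_dom s : 'E(S) := Idem (idem_sVs s).
Definition idem_ran s : 'E(S) := Idem (idem_ssV s).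
Definition idem_conjs s (e : 'E(S)) : 'E(S) := Idem (idem_conj s (idem_valP e)).

(* The action e . s = s^-1 e s of S on its idempotents; in the transition maps
   below it yields the Munn representation of S. *)
Program Definition conj_action : supported_action 'E(S) S :=
  @SupportedAction _ _ (fun e s => idem_conjs s e) (@idem_val S)
    (@idem_valP S) _ _ _.
Next Obligation. by apply: val_inj; rewrite /= sinvM !mulgA. Qed.
Next Obligation.
apply: val_inj; have ix := idem_valP x.
by rewrite /= (sinv_idem ix) !(idemE ix).
Qed.

End InverseSemigroups.

(** * Supported actions moved along a bijection of sets *)

Section Transport.
Variables (S : invSemigroupType) (X Y : Type) (A : supported_action X S).
Variables (f : X -> Y) (g : Y -> X).
Hypotheses (fK : cancel f g) (gK : cancel g f).

Program Definition transport_action : supported_action Y S :=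
  @SupportedAction _ _ (fun y s => f (act A (g y) s)) (fun y => supp A (g y))
    _ _ _ _.
Next Obligation. exact: supp_idem. Qed.
Next Obligation. by rewrite fK actM. Qed.
Next Obligation. by rewrite act_supp. Qed.
Next Obligation. by rewrite fK supp_act. Qed.

End Transport.

(** * Partial bijections induced by a supported action *)

Section Translations.
Variables (S : invSemigroupType) (X : Type) (A : supported_action X S).
Implicit Types (s t : S) (x y : X).

(** The test says that the support of [x] lies below $s^{-1}s$; exactly there is acting by $s^{-1}$
    undone by acting by $s$. *)
Definition translation_fun s x : option X :=
  if `[< supp A x * (sinv s * s) = supp A x >] then Some (act A x (sinv s))
  else None.

Lemma translation_funP s x y : translation_fun s x = Some y <->
  supp A x * (sinv s * s) = supp A x /\ y = act A x (sinv s).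
Proof.
rewrite /translation_fun; case: asboolP => [h|h]; last by split=> [|[]].
by split=> [[<-]|[_ ->]].
Qed.

Lemma translation_funV s x y :
  translation_fun s x = Some y -> translation_fun (sinv s) y = Some x.
Proof.
move=> /translation_funP[h ->]; apply/translation_funP; rewrite sinvK; split.
  by rewrite supp_act sinvK -!mulgA (mulgA (sinv s)) mulVsV.
by rewrite actM -[in RHS](act_supp A x) actM h act_supp.
Qed.

Lemma translation_funK s x y :
  translation_fun s x = Some y <-> translation_fun (sinv s) y = Some x.
Proof. by split=> /translation_funV; rewrite ?sinvK. Qed.

(* The inverse makes the right action a left one: the right factor of a product
   is then applied first, as in the generalised Munn semigroup. *)
Definition translation s : partial_bij X := PartialBij (translation_funK s).

Lemma translationP s x y : translation s x = Some y <->
  supp A x * (sinv s * s) = supp A x /\ y = act A x (sinv s).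
Proof. exact: translation_funP. Qed.

Lemma translationM s t :
  translation (s * t) = pb_comp (translation s) (translation t).
Proof.
(* The values agree by associativity of the action, so only domains matter: $p\le (st)^{-1}st$ iff
   $p\le t^{-1}t$ and $tpt^{-1}\le s^{-1}s$. *)
have ex x : supp A x * (sinv (s * t) * (s * t)) = supp A x <->
    supp A x * (sinv t * t) = supp A x /\
    supp A (act A x (sinv t)) * (sinv s * s) = supp A (act A x (sinv t)).
  rewrite supp_act sinvK sinvM; move: (supp A x) (supp_idem A x) => p ip.
  have ps := idemC ip (idem_sVs t).
  have ts := idemC (idem_sVs s) (idem_ssV t).
  split=> [h|[h1 h2]].
    have pt : p * (sinv t * t) = p.
      by rewrite -[in RHS]h -{1}h -!mulgA (mulgA t) mulsVs.
    split=> //.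
    suff <- : t * (p * (sinv t * sinv s * (s * t))) * sinv t =
              t * p * sinv t * (sinv s * s) by rewrite h.
    transitivity (t * p * sinv t * ((sinv s * s) * (t * sinv t))).
      by rewrite !mulgA.
    by rewrite ts !mulgA -!mulgA (mulgA (sinv t)) (mulgA (sinv t * t)) mulVsV.
  transitivity (p * (sinv t * t) * (sinv t * sinv s * (s * t))).
    by rewrite h1.
  rewrite ps; transitivity (sinv t * (t * p * sinv t * (sinv s * s)) * t).
    by rewrite !mulgA.
  by rewrite h2 !mulgA -ps -mulgA h1 h1.
apply: partial_bijP => x z; rewrite translationP; split.
  move=> [/ex[h1 h2] ->]; apply/pb_compP; exists (act A x (sinv t)).
    exact/translationP.
  by apply/translationP; split=> //; rewrite actM sinvM.
case/pb_compP=> y /translationP[h1 ->] /translationP[h2 ->].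
by rewrite actM sinvM; split=> //; rewrite -sinvM; apply/ex.
Qed.

Lemma translationV s : translation (sinv s) = pb_converse (translation s).
Proof.
apply: partial_bijP => x y; rewrite pb_converseP.
by rewrite [translation s y = _]translation_funK.
Qed.

Lemma translation_dom s :
  pb_dom (translation s) = [set x | supp A x * (sinv s * s) = supp A x].
Proof.
apply/seteqP; split=> x /=; first by case=> y /translationP[].
by move=> h; exists (act A x (sinv s)); apply/translationP.
Qed.

Lemma translation_cod s :
  pb_cod (translation s) = [set x | supp A x * (s * sinv s) = supp A x].
Proof.
have := translation_dom (sinv s); rewrite sinvK => <-.
by apply/seteqP; split=> y [x]; [move/pb_converseP|]; exists x;
  [|apply/pb_converseP]; rewrite -?translationV // translationV.
Qed.

Lemma translation_le s x x' y y' :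
  translation s x = Some y -> translation s x' = Some y' ->
  x = act A x' (supp A x) -> y = act A y' (supp A y).
Proof.
move=> /translationP[h ->] /translationP[h' ->] xx'.
rewrite {1}xx' supp_act !actM sinvK !mulgA.
by rewrite -(idemC (supp_idem A x) (idem_sVs s)) h.
Qed.

(** The order and the two subsets are parameters so that one lemma serves both components of an
    element of $T_X$: principal subpresheaves under [ple] and principal ideals under [sle].
    Monotonicity of the inverse is [translation_le] for [sinv s]. *)
Lemma translation_iso s (le : X -> X -> Prop) (D D' : set X) :
  (forall x y, le x y <-> x = act A y (supp A x)) ->
  (forall x, D x <-> supp A x * (sinv s * s) = supp A x) ->
  (forall x, D' x <-> supp A x * (s * sinv s) = supp A x) ->
  order_iso le D D' (translation s).
Proof.
move=> leE DE DE'; split.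
- by rewrite translation_dom; apply/seteqP; split=> x /= /DE.
- by rewrite translation_cod; apply/seteqP; split=> x /= /DE'.
- move=> x x' y y' xy xy'; rewrite !leE; split; first exact: translation_le xy xy'.
  have vxy : translation (sinv s) y = Some x by exact: translation_funV.
  have vxy' : translation (sinv s) y' = Some x' by exact: translation_funV.
  exact: translation_le vxy vxy'.
Qed.

End Translations.

(** * Partial identities and idempotent partial bijections *)

Section PartialIdentities.
Variable T : Type.
Implicit Types (D : set T) (a : partial_bij T).

Definition pid_fun D x : option T := if `[< D x >] then Some x else None.

Lemma pid_funP D x y : pid_fun D x = Some y <-> D x /\ y = x.
Proof.
rewrite /pid_fun; case: asboolP => [h|h]; last by split=> [|[]].
by split=> [[<-]|[_ ->]].
Qed.

Lemma pid_funK D x y : pid_fun D x = Some y <-> pid_fun D y = Some x.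
Proof. by rewrite !pid_funP; split=> -[h ->]. Qed.

Definition pid D : partial_bij T := PartialBij (pid_funK D).

Lemma pidP D x y : pid D x = Some y <-> D x /\ y = x.
Proof. exact: pid_funP. Qed.

Lemma pb_idem_pid a : pb_comp a a = a -> a = pid (pb_dom a).
Proof.
move=> aa; apply: partial_bijP => x y; rewrite pidP; split=> [axy|[[z axz] ->]].
  split; first by exists y.
  move: (axy); rewrite -{1}aa => /pb_compP[z axz azy].
  by move: axz; rewrite axy (pb_inj axy azy) => -[].
move: (axz); rewrite -{1}aa => /pb_compP[u axu auz].
by rewrite {2}(pb_inj axz auz).
Qed.

Lemma order_iso_pid (le : T -> T -> Prop) D : order_iso le D D (pid D).
Proof.
split.
- apply/seteqP; split=> x; first by case=> y /pidP[].
  by exists x; apply/pidP.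
- apply/seteqP; split=> x; first by case=> y /pidP[h ->].
  by exists x; apply/pidP.
- by move=> x x' y y' /pidP[_ ->] /pidP[_ ->].
Qed.

End PartialIdentities.

(** * Idempotents of $T_X$ and equivariance of its elements *)

Section Munn.
Variables (X : Type) (E : semilatticeType) (P : presheaf X E).
Implicit Types (e f g : E) (a b : munn P).

Lemma munn_fstM a b : munn_fst (a * b) = pb_comp (munn_fst a) (munn_fst b).
Proof. by []. Qed.

Lemma munn_sndM a b : munn_snd (a * b) = pb_comp (munn_snd a) (munn_snd b).
Proof. by []. Qed.

Lemma munn_fstV a : munn_fst (sinv a) = pb_converse (munn_fst a).
Proof. by []. Qed.

Lemma munn_sndV a : munn_snd (sinv a) = pb_converse (munn_snd a).
Proof. by []. Qed.

Lemma sle_anti e f : sle e f -> sle f e -> e = f.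
Proof. by rewrite /sle => ef fe; rewrite ef mulsC -fe. Qed.

Lemma pleP x y : ple P x y <-> exists e, x = act P y e.
Proof.
split=> [->|[e ->]]; first by exists (supp P x).
by rewrite /ple supp_actE -actM act_supp.
Qed.

Lemma ple_supp x y : ple P x y -> sle (supp P x) (supp P y).
Proof. by move=> /pleP[e ->]; rewrite supp_actE /sle mulsC -mulgA mulss. Qed.

(** This makes $y\cdot e$ the greatest element below $y$ with support below $e$, so the action is
    determined by order and support. *)
Lemma ple_act x y e : ple P x y -> sle (supp P x) e -> ple P x (act P y e).
Proof. by move=> xy xe; rewrite /ple actM mulsC -xe. Qed.

Lemma ple_anti x y : ple P x y -> ple P y x -> x = y.
Proof.
move=> xy yx; rewrite xy.
by rewrite (sle_anti (ple_supp xy) (ple_supp yx)) act_supp.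
Qed.

Lemma munn_supp a x y :
  munn_fst a x = Some y -> munn_snd a (supp P x) = Some (supp P y).
Proof. by case: (munn_iso a) => e [f [_ _]]; apply. Qed.

Lemma munn_id_iso e :
  exists k l, principal_iso P k l (pid (principal P e)) (pid (Defs.down e)).
Proof.
exists e, e; split; try exact: order_iso_pid.
by move=> x y /pidP[/principalE h ->]; apply/pidP.
Qed.

Definition munn_id e : munn P := Munn (munn_id_iso e).

Lemma munn_id_fst e x y :
  munn_fst (munn_id e) x = Some y <-> sle (supp P x) e /\ y = x.
Proof. by rewrite pidP principalE. Qed.

Lemma munn_id_snd e f g :
  munn_snd (munn_id e) f = Some g <-> sle f e /\ g = f.
Proof. exact: pidP. Qed.

Lemma munn_id_inj : injective munn_id.
Proof.
have half e f : munn_id e = munn_id f -> sle e f.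
  move=> ef; have : munn_snd (munn_id e) e = Some e.
    by apply/munn_id_snd; split=> //; exact: sle_refl.
  by rewrite ef => /munn_id_snd[].
by move=> e f ef; apply: sle_anti; apply: half.
Qed.

Lemma munn_idM e f : munn_id (e * f) = munn_id e * munn_id f.
Proof.
apply: munnP; apply: partial_bijP => x y; rewrite pb_compP.
  rewrite munn_id_fst sle_meet; split.
    by move=> [[xe xf] ->]; exists x; apply/munn_id_fst.
  by move=> [z /munn_id_fst[xf ->] /munn_id_fst[xe ->]].
rewrite munn_id_snd sle_meet; split.
  by move=> [[xe xf] ->]; exists x; apply/munn_id_snd.
by move=> [z /munn_id_snd[xf ->] /munn_id_snd[xe ->]].
Qed.

Lemma idem_munn_id e : idem (munn_id e).
Proof. by apply/eqP; rewrite -munn_idM mulss. Qed.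

(** An idempotent partial bijection is the identity on its domain, and both components of [a] have
    principal domains at the same [e]. *)
Lemma idem_munnP a : idem a -> exists e, a = munn_id e.
Proof.
move=> /eqP aa; have [e [f [[d _ _] [d' _ _] _]]] := munn_iso a; exists e.
by apply: munnP; rewrite /= -?d -?d'; apply: pb_idem_pid; rewrite -{3}aa.
Qed.

(** The idempotents $a^{-1}a$ and $aa^{-1}$ reveal the domain and range of the second component as
    the ideals below [e] and [f]; an order-isomorphism sends top to top. *)
Lemma munn_sndVVid a e f :
  sinv a * a = munn_id e -> a * sinv a = munn_id f -> munn_snd a e = Some f.
Proof.
move=> ae af; have [k [l [_ [domk codl mono] _]]] := munn_iso a.
have domE g : sle g e <-> exists h, munn_snd a g = Some h.
  have -> : sle g e <-> munn_snd (munn_id e) g = Some g.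
    by rewrite munn_id_snd; split=> [|[]].
  rewrite -ae munn_sndM munn_sndV pb_compP; split; first by case=> h ah _; exists h.
  by case=> h ah; exists h => //; apply/pb_converseP.
have codE h : sle h f <-> exists g, munn_snd a g = Some h.
  have -> : sle h f <-> munn_snd (munn_id f) h = Some h.
    by rewrite munn_id_snd; split=> [|[]].
  rewrite -af munn_sndM munn_sndV pb_compP; split.
    by case=> g /pb_converseP ag _; exists g.
  by case=> g ag; exists g => //; apply/pb_converseP.
have [h eh] := (domE e).1 (sle_refl e); have [g gf] := (codE f).1 (sle_refl f).
have hf : sle h f by apply/codE; exists e.
rewrite eh; congr Some; apply: sle_anti => //.
by apply/(mono _ _ _ _ gf eh)/domE; exists f.
Qed.

(** Elements of $T_X$ are only assumed to respect order and support, but by [ple_act] these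
    determine the action. *)
Lemma munn_fst_act a x y g h :
  munn_fst a x = Some y -> munn_snd a g = Some h ->
  munn_fst a (act P x g) = Some (act P y h).
Proof.
(* The defining inequality holds for a and its inverse alike. *)
have half b u v k l w : munn_fst b u = Some v -> munn_snd b k = Some l ->
    munn_fst b (act P u k) = Some w -> ple P w (act P v l).
  have [e [f [[_ _ mono] [_ _ mono'] _]]] := munn_iso b.
  move=> buv bkl buw; apply: ple_act.
    by apply/(mono _ _ _ _ buw buv)/pleP; exists k.
  apply/(mono' _ _ _ _ (munn_supp buw) bkl).
  by rewrite supp_actE /sle -mulgA mulss.
have dom b u v k : munn_fst b u = Some v ->
    exists w, munn_fst b (act P u k) = Some w.
  have [e [f [[d _ _] _ _]]] := munn_iso b.
  move=> buv; suff : pb_dom (munn_fst b) (act P u k) by [].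
  rewrite d; apply/principalE; have : pb_dom (munn_fst b) u by exists v.
  rewrite d => /principalE ue; apply: sle_trans ue.
  by rewrite supp_actE /sle mulsC -mulgA mulss.
move=> axy agh; have [w aw] := dom _ _ _ g axy.
rewrite aw; congr Some; apply: ple_anti; first exact: half axy agh aw.
(* For the reverse inequality, the preimage of $y\cdot h$ lies below $x\cdot g$ by [half] for
   $a^{-1}$; applying $a$ gives $y\cdot h\le w$. *)
have vyx : munn_fst (sinv a) y = Some x by rewrite munn_fstV pb_converseP.
have vhg : munn_snd (sinv a) h = Some g by rewrite munn_sndV pb_converseP.
have [u vu] := dom _ _ _ h vyx.
have ux := half _ _ _ _ _ _ vyx vhg vu.
have [e [f [[_ _ mono] _ _]]] := munn_iso a.
by move: vu; rewrite munn_fstV pb_converseP => au; apply/(mono _ _ _ _ au aw).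
Qed.

End Munn.

(** * From a supported action to a representation in $T_X$ *)

Section FromAction.
Variables (S : invSemigroupType) (E : semilatticeType) (X Y : Type).
Variables (P : presheaf X E) (A : supported_action Y S).
Variables (alpha : Y -> X) (beta : X -> Y).
Variables (theta : {multiplicative 'E(S) -> E}) (eta : E -> 'E(S)).
Hypotheses (alphaK : cancel alpha beta) (betaK : cancel beta alpha).
Hypotheses (thetaK : cancel theta eta) (etaK : cancel eta theta).
Hypothesis hom : sact_hom (restrict_idem A) P alpha theta.
Implicit Types (s t : S) (x y : X) (e : E).

(** [AX] and [AE] place the given action and the conjugation action on [X] and [E], so that both
    components of the representation are translations. *)
Let AX : supported_action X S := transport_action A alphaK betaK.
Let AE : supported_action E S :=
  transport_action (conj_action S) thetaK etaK.

Let suppX x : supp AX x = eta (supp P x).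
Proof. by rewrite -{2}[x]betaK (hom.2 (beta x)) thetaK. Qed.

Let actX x (u : 'E(S)) : act AX x u = act P x (theta u).
Proof. by rewrite -{2}[x]betaK -(hom.1 (beta x)). Qed.

Let pleE x y : ple P x y <-> x = act AX y (supp AX x).
Proof. by rewrite suppX actX etaK. Qed.

Let sle_theta e (u : 'E(S)) :
  sle e (theta u) <-> idem_val (eta e) * idem_val u = idem_val (eta e).
Proof.
rewrite /sle -{1 2}[e]etaK -gmulfM -idem_valM; split=> [/(can_inj thetaK) <- //|h].
by congr (theta _); apply/esym/val_inj.
Qed.

Let sleE e f : sle e f <-> e = act AE f (supp AE e).
Proof.
rewrite /sle -{1 2}[e]etaK -{1}[f]etaK -gmulfM.
suff -> : act AE f (supp AE e) = theta (eta e * eta f) by rewrite etaK.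
congr (theta _); apply: val_inj => /=.
rewrite (sinv_idem (idem_valP _)) (idemC (idem_valP (eta e)) (idem_valP (eta f))).
by rewrite -mulgA (idemE (idem_valP _)).
Qed.

Lemma translation_munn_iso s :
  exists k l, principal_iso P k l (translation AX s) (translation AE s).
Proof.
exists (theta (idem_dom s)), (theta (idem_ran s)); split.
- apply: translation_iso => [|x|x]; first exact: pleE.
    by rewrite principalE sle_theta suppX.
  by rewrite principalE sle_theta suppX.
- by apply: translation_iso => [|e|e]; [exact: sleE|exact: sle_theta..].
- move=> x y /translationP[h ->]; apply/translationP; split.
    by move: h; rewrite suppX.
  rewrite -[LHS]etaK; congr (theta _); apply: val_inj.
  by rewrite -[LHS]suppX supp_act suppX.
Qed.

Definition munn_rep s : munn P := Munn (translation_munn_iso s).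

Lemma munn_repM : {morph munn_rep : s t / s * t}.
Proof. by move=> s t; apply: munnP; apply: translationM. Qed.

(** Injectivity of [theta] then gives idempotent separation, and its surjectivity gives a wide
    image. *)
Lemma munn_rep_idem (u : 'E(S)) : munn_rep u = munn_id P (theta u).
Proof.
have iu := idem_valP u; apply: munnP; apply: partial_bijP => x y.
  rewrite munn_id_fst translationP sle_theta suppX (sinv_idem iu) (idemE iu).
  rewrite actX; split=> -[h ->]; split=> //.
    by rewrite -{1}(act_supp P x) actM -((sle_theta _ _).2 h) act_supp.
  by rewrite -{2}(act_supp P x) actM -((sle_theta _ _).2 h) act_supp.
rewrite munn_id_snd translationP sle_theta (sinv_idem iu) (idemE iu).
suff E1 : idem_val (eta x) * idem_val u = idem_val (eta x) -> act AE x u = x.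
  by split=> -[h ->]; rewrite E1.
move=> h; rewrite -[RHS]etaK; congr (theta _); apply: val_inj => /=.
by rewrite (sinv_idem iu) (idemC iu (idem_valP _)) -mulgA (idemE iu).
Qed.

Lemma munn_rep_of_action :
  exists phi : {multiplicative S -> munn P},
    [/\ idem_separating phi, inv_subsemigroup (range phi) & wide (range phi)].
Proof.
pose phi : {multiplicative S -> munn P} :=
  HB.pack munn_rep (isMultiplicative.Build _ _ munn_rep munn_repM).
exists phi; split.
- move=> u v iu iv /=.
  rewrite -[u]/(idem_val (Idem iu)) -[v]/(idem_val (Idem iv)) !munn_rep_idem.
  by move=> /munn_id_inj/(can_inj thetaK) ->.
- split; first by move=> _ _ [s _ <-] [t _ <-]; exists (s * t); rewrite ?gmulfM.
  by move=> _ [s _ <-]; exists (sinv s); rewrite ?gmulfV.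
- move=> a /idem_munnP[e ->]; exists (idem_val (eta e)) => //=.
  by rewrite munn_rep_idem etaK.
Qed.

End FromAction.

(** * From a representation in $T_X$ to a supported action *)

Section FromMunn.
Variables (S : invSemigroupType) (E : semilatticeType) (X : Type).
Variables (P : presheaf X E) (phi : {multiplicative S -> munn P}).
Hypotheses (sep : idem_separating phi) (wid : wide (range phi)).
Implicit Types (s t : S) (x y : X) (u v : 'E(S)).

Lemma idem_image u : exists e, phi (idem_val u) = munn_id P e.
Proof.
apply: idem_munnP; apply/eqP.
by rewrite -gmulfM (idemE (idem_valP u)).
Qed.

Definition idem_map u : E := sval (cid (idem_image u)).

Lemma idem_mapE u : phi (idem_val u) = munn_id P (idem_map u).
Proof. exact: svalP (cid (idem_image u)). Qed.

Lemma idem_mapM : {morph idem_map : u v / u * v}.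
Proof.
move=> u v; apply: (@munn_id_inj _ _ P).
by rewrite munn_idM -!idem_mapE idem_valM gmulfM.
Qed.

HB.instance Definition _ := isMultiplicative.Build _ _ idem_map idem_mapM.

Lemma idem_map_inj : injective idem_map.
Proof.
move=> u v uv; apply/val_inj/sep; rewrite ?unfold_in; try exact: idem_valP.
by rewrite !idem_mapE uv.
Qed.

Lemma idem_map_surj e : exists u, idem_map u = e.
Proof.
have [s _ se] := wid (idem_munn_id P e).
(* Wideness gives some preimage [s], perhaps not idempotent; $s^{-1}s$ is idempotent and has the
   same image. *)
exists (idem_dom s); apply: (@munn_id_inj _ _ P); rewrite -idem_mapE /=.
rewrite gmulfM gmulfV se (sinv_idem (idem_munn_id P e)).
exact: idemE (idem_munn_id P e).
Qed.

Definition idem_map_inv e : 'E(S) := sval (cid (idem_map_surj e)).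

Lemma idem_map_invK : cancel idem_map_inv idem_map.
Proof. by move=> e; exact: svalP (cid (idem_map_surj e)). Qed.

Lemma idem_mapK : cancel idem_map idem_map_inv.
Proof. by move=> u; apply: idem_map_inj; rewrite idem_map_invK. Qed.

(** The element $su$ has $(su)^{-1}su=s^{-1}su$ and $su(su)^{-1}=sus^{-1}$, so [munn_sndVVid]
    evaluates its image; the factor [phi u] is a partial identity, so [phi s] takes the same
    value. *)
Lemma munn_snd_conj s u :
  munn_snd (phi s) (idem_map (idem_dom s * u)) =
  Some (idem_map (idem_conjs (sinv s) u)).
Proof.
have iu := idem_valP u.
have : munn_snd (phi (s * idem_val u)) (idem_map (idem_dom s * u)) =
       Some (idem_map (idem_conjs (sinv s) u)).
  apply: munn_sndVVid; rewrite -gmulfV -gmulfM -idem_mapE; congr (phi _).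
    rewrite idem_valM /= sinvM (sinv_idem iu) (idemC (idem_sVs s) iu).
    transitivity (idem_val u * ((sinv s * s) * idem_val u)); first by rewrite !mulgA.
    by rewrite (idemC (idem_sVs s) iu) mulgA (idemE iu).
  by rewrite /= sinvM (sinv_idem iu) sinvK !mulgA -(mulgA s (idem_val u) (idem_val u)) (idemE iu).
rewrite gmulfM munn_sndM pb_compP idem_mapE.
by case=> e /munn_id_snd[_ ->].
Qed.

Lemma munn_act_ex s x : exists y,
  munn_fst (phi (sinv s)) (act P x (idem_map (idem_ran s))) = Some y.
Proof.
have : munn_fst (phi (idem_val (idem_ran s))) (act P x (idem_map (idem_ran s))) =
       Some (act P x (idem_map (idem_ran s))).
  rewrite idem_mapE; apply/munn_id_fst; split=> //.
  by rewrite supp_actE /sle -mulgA mulss.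
(* Since $\phi(ss^{-1})=\phi(s)\phi(s^{-1})$ is defined at this point, so is the factor applied
   first. *)
by rewrite gmulfM munn_fstM pb_compP => -[y xy _]; exists y.
Qed.

Definition munn_act x s : X := sval (cid (munn_act_ex s x)).

Lemma munn_actE s x :
  munn_fst (phi (sinv s)) (act P x (idem_map (idem_ran s))) =
  Some (munn_act x s).
Proof. exact: svalP (cid (munn_act_ex s x)). Qed.

Definition munn_act_supp x : 'E(S) := idem_map_inv (supp P x).

Lemma munn_act_suppE x s : munn_act_supp (munn_act x s) =
  idem_conjs s (munn_act_supp x).
Proof.
have := munn_supp (munn_actE s x).
rewrite supp_actE -[supp P x in LHS]idem_map_invK mulsC -idem_mapM.
have -> : idem_ran s = idem_dom (sinv s) by apply: val_inj; rewrite /= sinvK.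
rewrite munn_snd_conj => -[/(congr1 idem_map_inv)].
rewrite idem_mapK /munn_act_supp => <-.
by rewrite sinvK.
Qed.

Lemma munn_actM x s t : munn_act (munn_act x s) t = munn_act x (s * t).
Proof.
(* The aim is to evaluate $\phi(t^{-1})\phi(s^{-1})$ at $x\cdot(st)(st)^{-1}$. Conjugation turns
   $s\,tt^{-1}s^{-1}$ into $s^{-1}s\,tt^{-1}$, and equivariance carries this over to [X]. *)
have E1 : munn_snd (phi (sinv s)) (idem_map (idem_conjs (sinv s) (idem_ran t))) =
          Some (idem_map (idem_dom s * idem_ran t)).
  by rewrite gmulfV munn_sndV pb_converseP munn_snd_conj.
have := munn_fst_act (munn_actE s x) E1.
have -> : act P (act P x (idem_map (idem_ran s)))
            (idem_map (idem_conjs (sinv s) (idem_ran t))) =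
          act P x (idem_map (idem_ran (s * t))).
  rewrite actM -idem_mapM; congr (act _ _ (idem_map _)); apply: val_inj.
  by rewrite /= sinvK sinvM !mulgA mulsVs.
(* The factor $s^{-1}s$ is absorbed, because the support $s^{-1}p\,s$ of [munn_act x s] lies below
   it. *)
have -> : act P (munn_act x s) (idem_map (idem_dom s * idem_ran t)) =
          act P (munn_act x s) (idem_map (idem_ran t)).
  rewrite idem_mapM -actM; congr (act _ _ _).
  rewrite -[X in act _ X _](act_supp P) actM -[supp P _]idem_map_invK -idem_mapM.
  rewrite -[in RHS](act_supp P (munn_act x s)) -[in RHS](idem_map_invK (supp P _)).
  congr (act _ _ (idem_map _)); apply: val_inj.
  rewrite -/(munn_act_supp _) munn_act_suppE /=.
  by rewrite -!mulgA (mulgA s) mulsVs.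
move=> xy; have := munn_actE (s * t) x.
rewrite sinvM gmulfM munn_fstM pb_compP => -[y].
by rewrite xy => -[<-]; rewrite munn_actE => -[].
Qed.

(** This identifies the restricted action with [P] along [idem_map], and also yields the axiom that
    the support of [x] fixes [x]. *)
Lemma munn_act_idem x u : munn_act x (idem_val u) = act P x (idem_map u).
Proof.
have iu := idem_valP u; have := munn_actE (idem_val u) x.
have -> : idem_ran (idem_val u) = u.
  by apply: val_inj; rewrite /= (sinv_idem iu) (idemE iu).
by rewrite (sinv_idem iu) idem_mapE => /munn_id_fst[].
Qed.

Program Definition munn_action : supported_action X S :=
  @SupportedAction _ _ munn_act munn_act_supp _ _ _ _.
Next Obligation. exact: idem_valP. Qed.
Next Obligation. exact: munn_actM. Qed.
Next Obligation. by rewrite munn_act_idem idem_map_invK act_supp. Qed.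
Next Obligation. by rewrite munn_act_suppE. Qed.

Lemma action_of_munn_rep :
  exists A : supported_action X S, sact_isomorphic (restrict_idem A) P.
Proof.
exists munn_action, id, idem_map; split.
- split=> [x u|x] /=; first exact: munn_act_idem.
  rewrite -[LHS]idem_map_invK; congr (idem_map _); exact: val_inj.
- by exists id.
- by exists idem_map_inv; [exact: idem_mapK|exact: idem_map_invK].
Qed.

End FromMunn.

Theorem theoremD (S : invSemigroupType) (X : Type) (P : presheaf X 'E(S)) :
  (exists phi : {multiplicative S -> munn P},
     [/\ idem_separating phi, inv_subsemigroup (range phi) & wide (range phi)])
  <->
  (exists A : supported_action X S, sact_isomorphic (restrict_idem A) P).
Proof.
split=> [[phi [sep _ wid]]|[A [alpha [theta [hom [beta aK bK] [eta tK eK]]]]]].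
  exact: action_of_munn_rep sep wid.
exact: munn_rep_of_action aK bK tK eK hom.
Qed.
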